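(* Let $a\in\mathbb{R}$, $0<\alpha<1$, $g\in C([a,\infty),\mathbb{R})$ and $x_a>0$. Then the solution $x$ of the initial value problem $${}^{C}D_{a^+}^{\alpha}[x](t)=g(t)x(t),\quad x(a)=x_a,$$ is positive on $[a,\infty)$, i.e. $x(t)>0$ for all $t\in[a,\infty)$.
   Context: For an interval $I\subset\mathbb{R}$, $L^1_{loc}(I,\mathbb{R})$ and $AC_{loc}(I,\mathbb{R})$ denote the functions that are, respectively, integrable and absolutely continuous on every compact subinterval of $I$. Here $I=[a,\infty)$. Left Riemann--Liouville fractional integral of order $\beta>0$ of $f\in L^1_{loc}(I,\mathbb{R})$: $I_{a^+}^{\beta}[f](t)=\frac{1}{\Gamma(\beta)}\int_a^t (t-s)^{\beta-1}f(s)\,ds$, $t\ge a$ (whenever it exists); $I_{a^+}^0[f]=f$. Left Riemann--Liouville fractional derivative of order $0<\alpha\le 1$ of $f\in L^1_{loc}(I,\mathbb{R})$ with $I_{a^+}^{1-\alpha}[f]\in AC_{loc}(I,\mathbb{R})$: $D_{a^+}^{\alpha}[f](t)=\frac{d}{dt}\left[I_{a^+}^{1-\alpha}[f]\right](t)$. The set of such $f$ is denoted $AC_{a^+}^{\alpha}(I,\mathbb{R})$. Left Caputo fractional derivative of order $0<\alpha\le1$ of $f\in C(I,\mathbb{R})$ with $f-f(a)\in AC_{a^+}^{\alpha}(I,\mathbb{R})$: ${}^{C}D_{a^+}^{\alpha}[f](t)=D_{a^+}^{\alpha}[f-f(a)](t)$. A solution is a continuous function on $[a,\infty)$ possessing a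 left Caputo derivative of order $\alpha$ and satisfying the equation and the initial condition; existence and uniqueness of the solution on $[a,\infty)$ is known. *)

(* Defs.v *)
From HB Require Import structures.
From mathcomp Require Import all_boot all_order all_algebra.
From mathcomp Require Import all_classical all_reals all_analysis.
Import numFieldNormedType.Exports.
Import Order.TTheory GRing.Theory Num.Theory.

Set Implicit Arguments.
Unset Strict Implicit.
Unset Printing Implicit Defensive.

Local Open Scope classical_set_scope.
Local Open Scope ring_scope.

Section FractionalCalculus.
Context {R : realType}.

(* Functions on an interval I are total functions R -> R of which only the
   values on I are used. *)

Definition Gamma (b : R) : R :=
  \int[lebesgue_measure]_(s in `]0, +oo[) (s `^ (b - 1) * expR (- s)).

Definition L1loc (I : set R) (f : R -> R) : Prop :=
  forall c d : R, `[c, d] `<=` I ->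
    lebesgue_measure.-integrable `[c, d] (EFin \o f).

Definition AC (c d : R) (F : R -> R) : Prop :=
  forall e : R, 0 < e -> exists2 r : R, 0 < r &
    forall (n : nat) (u v : 'I_n -> R),
      (forall i, [/\ c <= u i, u i <= v i & v i <= d]) ->
      trivIset setT (fun i => `]u i, v i[%classic) ->
      \sum_(i < n) (v i - u i) < r ->
      \sum_(i < n) `|F (v i) - F (u i)| < e.

Definition ACloc (I : set R) (F : R -> R) : Prop :=
  forall c d : R, `[c, d] `<=` I -> AC c d F.

Definition rl_kernel (b : R) (f : R -> R) (t s : R) : R :=
  (t - s) `^ (b - 1) * f s.

Definition rl_integral (a b : R) (f : R -> R) (t : R) : R :=
  if b == 0 then f t
  else (Gamma b)^-1 * \int[lebesgue_measure]_(s in `[a, t]) rl_kernel b f t s.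

(* rl_integral has a default value when the kernel is not
   integrable; this predicate says that the integral really exists. *)
Definition rl_integral_exists (a b : R) (f : R -> R) (t : R) : Prop :=
  b != 0 ->
  lebesgue_measure.-integrable `[a, t] (EFin \o rl_kernel b f t).

(* The set AC_{a+}^alpha([a, +oo[, R). *)
Definition rl_derivable (a alpha : R) (f : R -> R) : Prop :=
  [/\ L1loc `[a, +oo[ f,
      forall t, a <= t -> rl_integral_exists a (1 - alpha) f t &
      ACloc `[a, +oo[ (rl_integral a (1 - alpha) f)].

(* A locally absolutely continuous function is differentiable almost
   everywhere only, hence the separate predicate for the existence of the
   derivative at t; derive1 has a default value elsewhere. *)
Definition rl_derivable_at (a alpha : R) (f : R -> R) (t : R) : Prop :=
  derivable (rl_integral a (1 - alpha) f) t 1.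

Definition rl_derive (a alpha : R) (f : R -> R) (t : R) : R :=
  derive1 (rl_integral a (1 - alpha) f) t.

Definition caputo_derivable (a alpha : R) (f : R -> R) : Prop :=
  {within `[a, +oo[, continuous f} /\
  rl_derivable a alpha (fun t => f t - f a).

Definition caputo_derivable_at (a alpha : R) (f : R -> R) (t : R) : Prop :=
  rl_derivable_at a alpha (fun s => f s - f a) t.

Definition caputo_derive (a alpha : R) (f : R -> R) (t : R) : R :=
  rl_derive a alpha (fun s => f s - f a) t.

(* The Caputo derivative is an almost everywhere defined function, so the
   equation is required for almost every t in [a, +oo[; in particular the
   one-sided behaviour at the endpoint a is irrelevant. *)
Definition caputo_linear_solution (a alpha : R) (g : R -> R) (xa : R)
    (x : R -> R) : Prop :=
  [/\ caputo_derivable a alpha x,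
      {ae lebesgue_measure, forall t, a <= t ->
         caputo_derivable_at a alpha x t /\
         caputo_derive a alpha x t = g t * x t} &
      x a = xa].

End FractionalCalculus.

(* Main.v *)
Require Import Defs.
From mathcomp Require Import all_boot all_order all_algebra.
From mathcomp Require Import all_classical all_reals all_analysis.
From mathcomp Require Import measurable_realfun.
From mathcomp Require Import ring lra.
Import Order.TTheory GRing.Theory Num.Theory.
Import numFieldNormedType.Exports.
Set Implicit Arguments.
Unset Strict Implicit.
Unset Printing Implicit Defensive.

Local Open Scope classical_set_scope.
Local Open Scope ring_scope.

(** Suppose that the solution x vanishes somewhere and let b > a be its first
zero. Put q = 1 - alpha and, for a bounded function z, let
X_z(t) be the integral of (t - s)^(q - 1) z(s) over s < t.

Since g is only continuous, x need not be differentiable, and the classical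
argument, the sign of the Caputo derivative at a minimum, is not available
at b. It is replaced by an averaged version of it.

- The equation says that F = I^q[x - x(a)] is absolutely continuous with
  F' = g x almost everywhere, and Gamma(q) F = X_x - x(a) X_1, where X_1 is the
  potential of the indicator of [a, b]. Near b the product g x is as small as
  desired because x(b) = 0, so F decreases at most at a small rate
  ([AC_derive_ge]), whereas X_1 grows at least at the rate (b - a)^(q - 1)
  ([potential_indic_growth]). Hence X_x(t) - X_x(t - k) >= e k just before b,
  for some e > 0.

- Average this against the dual kernel u^(alpha - 1) on ]0, h[. By Tonelli
  ([beta_averageE]) the average of X_x is the integral of x(s) kappa(t - s),
  where kappa(w) is the integral of u^(alpha - 1) (w - u)^(q - 1) over
  0 < u < min(h, w). Because alpha + q = 1, kappa is invariant under scaling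
  except for the truncation at h, so that it is bounded and nonincreasing
  on ]0, +oo[. As x >= 0, shifting t from b - k to b increases the integral of
  x(s) kappa(t - s) by at most B k sup x, the supremum being over [b - k, b]
  ([beta_average_upper]), while it must increase by at least a constant
  times k ([beta_average_lower]).

So the supremum of x over [b - k, b] is bounded below by a positive constant
when k tends to 0 ([abel_strict]), which contradicts x(b) = 0. *)

(** * Affine changes of variable *)

Section change_of_variable.
Context {R : realType}.
Notation mu := (@lebesgue_measure R).

Lemma lebesgue_measure_affine (c d : R) (A : set R) : 0 < c -> measurable A ->
  mu A = (c%:E * mu ((fun v : R => (c * v + d)%R) @^-1` A))%E.
Proof.
move=> c0 mA.
pose f : R -> measurableTypeR R := fun v => c * v + d.
have mf : measurable_fun [set: measurableTypeR R] f.
  by apply: measurable_funD => //; exact: measurable_funM.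
pose k := NngNum (ltW c0).
rewrite (@lebesgue_measure_unique R (mscale k (pushforward mu f))) => //=.
move=> _ [[a b]] _ <- /=.
rewrite /mscale /= /pushforward/=.
have -> : f @^-1` `]a, b] = `](a - d) / c, (b - d) / c]%classic.
  apply/seteqP; split => x /=; rewrite !in_itv /= /f ltr_pdivrMr// ler_pdivlMr//.
    by move=> /andP[? ?]; apply/andP; split; lra.
  by move=> /andP[? ?]; apply/andP; split; lra.
rewrite !lebesgue_measure_itv/= !lte_fin ltr_pM2r ?invr_gt0// ltrD2r.
case: ifPn => _; last by rewrite mule0.
rewrite -!EFinD -EFinM; congr (_%:E); field; lra.
Qed.

Lemma ge0_integral_affine (c d : R) (f : R -> \bar R) : 0 < c ->
  measurable_fun [set: R] f -> (forall r, 0 <= f r)%E ->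
  (\int[mu]_u f u = c%:E * \int[mu]_v f (c * v + d)%R)%E.
Proof.
move=> c0 mf f0.
pose g : R -> measurableTypeR R := fun v => c * v + d.
have mg : measurable_fun [set: measurableTypeR R] g.
  by apply: measurable_funD => //; exact: measurable_funM.
have := @ge0_integral_pushforward _ _ (measurableTypeR R) (measurableTypeR R) R
  g mg mu setT f measurableT mf (fun r _ => f0 r).
rewrite preimage_setT => /= <-.
rewrite -(@ge0_integral_mscale _ _ _ _ _ measurableT (NngNum (ltW c0)))//.
by apply: eq_measure_integral => A mA _ /=; exact: lebesgue_measure_affine.
Qed.

Lemma ge0_integral_reflect (d : R) (f : R -> \bar R) :
  measurable_fun [set: R] f -> (forall r, 0 <= f r)%E ->
  (\int[mu]_u f u = \int[mu]_v f (d - v)%R)%E.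
Proof.
move=> mf f0.
have mN : measurable_fun [set: measurableTypeR R] (-%R : R -> measurableTypeR R) by [].
transitivity (\int[mu]_v f (- v)%R)%E.
  have := @ge0_integral_pushforward _ _ (measurableTypeR R) (measurableTypeR R) R
    _ mN mu setT f measurableT mf (fun r _ => f0 r).
  rewrite preimage_setT => /= <-.
  by apply: eq_measure_integral => A mA _ /=; exact/esym/lebesgue_measureN.
rewrite (@ge0_integral_affine 1 (- d) (fun v => f (- v)))//.
  rewrite mul1e; apply: eq_integral => v _; congr f; lra.
exact: measurableT_comp.
Qed.

End change_of_variable.

(** * Power kernels *)

Section power_kernel.
Context {R : realType}.
Notation mu := (@lebesgue_measure R).

(** The cut-off at 0 turns the convolutions below into integrals over the
whole line, where translations and scalings need no bookkeeping of domains. *)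
Definition power_kernel (p w : R) : R := if 0 < w then w `^ (p - 1) else 0.

Lemma power_kernel_ge0 p w : 0 <= power_kernel p w.
Proof. by rewrite /power_kernel; case: ifP => // _; exact: powR_ge0. Qed.

Lemma measurable_power_kernel p : measurable_fun [set: R] (power_kernel p).
Proof.
apply: measurable_fun_ifT => //; first exact: measurable_fun_ltr.
Qed.

Lemma power_kernelM (p c v : R) : 0 < c ->
  power_kernel p (c * v) = c `^ (p - 1) * power_kernel p v.
Proof.
move=> c0; rewrite /power_kernel pmulr_rgt0//; case: ifP => v0; last by rewrite mulr0.
by rewrite powRM// ltW.
Qed.

Lemma le_power_kernel (p v w : R) : p <= 1 -> 0 < v -> v <= w ->
  power_kernel p w <= power_kernel p v.
Proof.
move=> p1 v0 vw; have w0 := lt_le_trans v0 vw.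
rewrite /power_kernel v0 w0.
have -> : p - 1 = - (1 - p) by lra.
rewrite !powRN lef_pV2 ?posrE ?powR_gt0//.
by rewrite ge0_ler_powR ?nnegrE ?subr_ge0// ltW.
Qed.

(** The primitive u^p / p bounds the integrals over [c / (n + 2), c], and
these intervals exhaust ]0, c]. *)
Lemma integral_power_lty (p c : R) : 0 < p -> 0 < c ->
  (\int[mu]_(u in `]0%R, c]) (power_kernel p u)%:E < +oo)%E.
Proof.
move=> p0 c0.
pose F (n : nat) : set R := `[c / n.+2%:R, c]%classic.
have c_gt0 n : 0 < c / n.+2%:R :> R by rewrite divr_gt0.
have c_lt n : c / n.+2%:R < c :> R.
  by rewrite ltr_pdivrMr// ltr_pMr// (_ : 1 = 1%:R)// ltr_nat.
have Fint n : (\int[mu]_(u in F n) (power_kernel p u)%:E <= (c `^ p / p)%:E)%E.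
  pose P : R -> R := fun u => u `^ p / p.
  have dP (z : R) : 0 < z -> is_derive z 1 P (z `^ (p - 1)).
    move=> z0; rewrite /P.
    have -> : (fun u : R => u `^ p / p) = p^-1 \*: (@powR R ^~ p).
      by apply/funext => u; rewrite /= mulrC.
    have -> : z `^ (p - 1) = p^-1 *: (p * z `^ (p - 1)) :> R.
      by rewrite /GRing.scale/=; field; lra.
    by apply: is_deriveZ; exact: is_derive1_powR.
  have cP (z : R) : 0 < z -> {for z, continuous P}.
    move=> z0; apply: differentiable_continuous; apply/derivable1_diffP.
    by have [] := dP z z0.
  have cp (z : R) : 0 < z -> {for z, continuous (fun u : R => u `^ (p - 1))}.
    move=> z0; apply: differentiable_continuous; apply/derivable1_diffP.
    by apply: derivable_powR; rewrite in_itv/= andbT.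
  have -> : (\int[mu]_(u in F n) (power_kernel p u)%:E =
      \int[mu]_(u in F n) (u `^ (p - 1))%:E)%E.
    apply: eq_integral => u; rewrite inE /F /= in_itv /= => /andP[cu _].
    by rewrite /power_kernel (lt_le_trans (c_gt0 n) cu).
  rewrite (@continuous_FTC2 _ _ P)//.
  - rewrite -EFinD lee_fin /P gerBl// divr_ge0 ?powR_ge0//; exact: ltW.
  - apply: continuous_in_subspaceT => z; rewrite inE /= in_itv /= => /andP[cz _].
    by apply: cp; exact: lt_le_trans cz.
  - split.
    + move=> z; rewrite in_itv /= => /andP[cz _].
      by have [] := dP z (lt_trans (c_gt0 n) cz).
    + by apply: cvg_at_right_filter; exact: cP.
    + by apply: cvg_at_left_filter; exact: cP.
  - move=> z; rewrite in_itv /= => /andP[cz _].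
    by rewrite derive1E; have [_ ->] := dP z (lt_trans (c_gt0 n) cz).
have -> : `]0%R, c]%classic = \bigcup_n F n.
  apply/seteqP; split => u /=; last first.
    move=> [n _]; rewrite /F /= !in_itv /= => /andP[cu ->].
    by rewrite (lt_le_trans (c_gt0 n) cu).
  rewrite in_itv /= => /andP[u0 uc].
  exists (Num.truncn (c / u)) => //; rewrite /F /= in_itv /= uc andbT.
  rewrite ler_pdivrMr// mulrC -ler_pdivrMr//.
  apply: ltW; apply: lt_trans (_ : (Num.truncn (c / u)).+1%:R < _).
    exact: Num.Theory.truncnS_gt.
  by rewrite ltr_nat.
have cvF : (\int[mu]_(u in F n) (power_kernel p u)%:E)%E @[n --> \oo] -->
    (\int[mu]_(u in \bigcup_n F n) (power_kernel p u)%:E)%E.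
  apply: ge0_nondecreasing_set_cvg_integral.
  - move=> m n mn; rewrite subsetEset => u; rewrite /F /= !in_itv /= => /andP[mu_ ->].
    rewrite andbT (le_trans _ mu_)// ler_pM2l// lef_pV2 ?posrE// ler_nat.
    by rewrite ltnS.
  - by move=> n; exact: measurable_itv.
  - move=> n; apply: measurable_funTS; apply/measurable_EFinP.
    exact: measurable_power_kernel.
  - by move=> n u _; rewrite lee_fin power_kernel_ge0.
apply: le_lt_trans (ltry (c `^ p / p)).
rewrite -(cvg_lim (@ereal_hausdorff R) cvF).
by apply: lime_le; [exact: cvgP cvF|exact: nearW].
Qed.

End power_kernel.

(** * Truncated beta convolutions *)

Section beta_convolution.
Context {R : realType}.
Notation mu := (@lebesgue_measure R).

Lemma measurable_fun_restrictT (D : set R) (f : R -> \bar R) : measurable D ->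
  measurable_fun [set: R] f -> measurable_fun [set: R] (f \_ D).
Proof. by move=> mD mf; apply/(measurable_restrictT f mD); exact: measurable_funTS. Qed.

(** Without the truncation at h this is the beta integral, multiplied by
w^(p + q - 1). *)
Definition truncated_beta (p q h w : R) : \bar R :=
  (\int[mu]_(u in `]0%R, h[) (power_kernel p u * power_kernel q (w - u))%:E)%E.

Lemma measurable_power_kernel2 (p q w : R) :
  measurable_fun [set: R] (fun u => (power_kernel p u * power_kernel q (w - u))%:E).
Proof.
apply/measurable_EFinP; apply: measurable_funM; first exact: measurable_power_kernel.
apply: (measurableT_comp (measurable_power_kernel q)).
exact: measurable_funB.
Qed.

Lemma power_kernel2_ge0 (p q w u : R) :
  (0 <= (power_kernel p u * power_kernel q (w - u))%:E)%E.
Proof. by rewrite lee_fin mulr_ge0// power_kernel_ge0. Qed.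

Lemma truncated_beta_ge0 (p q h w : R) : (0 <= truncated_beta p q h w)%E.
Proof. by apply: integral_ge0 => u _; exact: power_kernel2_ge0. Qed.

Lemma truncated_beta_le0 (p q h w : R) : w <= 0 -> truncated_beta p q h w = 0%E.
Proof.
move=> w0; apply: integral0_eq => u /=; rewrite in_itv /= => /andP[u0 _].
by rewrite {2}/power_kernel ltNge (_ : w - u <= 0) ?mulr0//; lra.
Qed.

(** When p + q = 1 the substitution u = w v leaves the integrand unchanged:
the factors w, w^(p - 1) and w^(q - 1) cancel. *)
Lemma truncated_beta_scale (p q h w : R) : 0 < q -> p + q = 1 -> 0 < w ->
  truncated_beta p q h w = truncated_beta p q (h / w) 1.
Proof.
move=> q0 pq w0; rewrite /truncated_beta [LHS]integral_mkcond [RHS]integral_mkcond.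
rewrite (@ge0_integral_affine _ w 0)//; last 2 first.
- by apply: measurable_fun_restrictT => //; exact: measurable_power_kernel2.
- by move=> u; apply: erestrict_ge0 => {}u _; exact: power_kernel2_ge0.
rewrite -ge0_integralZl//=; last 3 first.
- apply: (measurableT_comp (f := (_ \_ `]0%R, h[))).
    by apply: measurable_fun_restrictT => //; exact: measurable_power_kernel2.
  by apply: measurable_funD => //; exact: measurable_funM.
- by move=> u _; apply: erestrict_ge0 => {}u _; exact: power_kernel2_ge0.
- by rewrite lee_fin ltW.
apply: eq_integral => v _; rewrite !patchE.
have -> : (w * v + 0 \in `]0, h[%classic) = (v \in `]0, h / w[%classic).
  rewrite !mem_setE !in_itv /= addr0 pmulr_rgt0// ltr_pdivlMr//.
  by rewrite (mulrC v).
case: ifP => _; last by rewrite mule0.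
rewrite addr0 -EFinM; congr _%:E.
have -> : w - w * v = w * (1 - v) by ring.
rewrite !power_kernelM// [LHS](_ : _ = (w * w `^ (p - 1) * w `^ (q - 1)) *
  (power_kernel p v * power_kernel q (1 - v))); last by ring.
suff -> : w * w `^ (p - 1) * w `^ (q - 1) = 1 by rewrite mul1r.
have -> : p - 1 = - q by lra.
by rewrite mulrAC mulr_powRB1 ?(ltW w0)// powRN divff// gt_eqF// powR_gt0.
Qed.

(** After scaling, w only enters through the domain ]0, h / w[, which shrinks
when w grows. *)
Lemma truncated_beta_nonincreasing (p q h w w' : R) :
  0 < q -> p + q = 1 -> 0 < w -> w <= w' -> 0 < h ->
  (truncated_beta p q h w' <= truncated_beta p q h w)%E.
Proof.
move=> q0 pq w0 ww' h0; have w'0 := lt_le_trans w0 ww'.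
rewrite (truncated_beta_scale _ q0 pq w0) (truncated_beta_scale _ q0 pq w'0).
apply: ge0_subset_integral => //=.
- by apply: measurable_funTS; exact: measurable_power_kernel2.
- by move=> u _; exact: power_kernel2_ge0.
- move=> u /=; rewrite !in_itv /= => /andP[-> uh]; rewrite (lt_le_trans uh)//.
  by rewrite ler_pM2l// lef_pV2.
Qed.

(** Each factor is singular at one end of ]0, 1[ only, and is at most its
value at 1/2 on the half which contains the other end. *)
Lemma beta_integral_lty (p q : R) : 0 < p <= 1 -> 0 < q <= 1 ->
  (\int[mu]_u (power_kernel p u * power_kernel q (1 - u))%:E < +oo)%E.
Proof.
move=> /andP[p0 p1] /andP[q0 q1].
pose I (r u : R) : \bar R := (((EFin \o power_kernel r) \_ `]0%R, 1%R]) u)%E.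
have mI r : measurable_fun [set: R] (I r).
  apply: measurable_fun_restrictT => //; apply/measurable_EFinP.
  exact: measurable_power_kernel.
have I0 r u : (0 <= I r u)%E.
  by apply: erestrict_ge0 => {}u _; rewrite lee_fin power_kernel_ge0.
have Ilty r : 0 < r -> (\int[mu]_u I r u < +oo)%E.
  by move=> r0; rewrite -integral_mkcond; exact: integral_power_lty.
have mI1 r : measurable_fun [set: R] (fun u => I r (1 - u)).
  by apply: (measurableT_comp (mI r)); exact: measurable_funB.
pose cp := power_kernel p 2^-1; pose cq := power_kernel q 2^-1.
have cp0 : (0 <= cp%:E)%E by rewrite lee_fin power_kernel_ge0.
have cq0 : (0 <= cq%:E)%E by rewrite lee_fin power_kernel_ge0.
have m1 : measurable_fun [set: R] (fun u => cq%:E * I p u)%E.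
  exact: measurable_funeM.
have m2 : measurable_fun [set: R] (fun u => cp%:E * I q (1 - u)%R)%E.
  exact: measurable_funeM.
apply: (@le_lt_trans _ _
  (\int[mu]_u (cq%:E * I p u + cp%:E * I q (1 - u)%R))%E); last first.
  rewrite ge0_integralD//; last 2 first.
  - by move=> u _; rewrite mule_ge0.
  - by move=> u _; rewrite mule_ge0.
  have Ir : (\int[mu]_v I q (1 - v)%R < +oo)%E by rewrite -ge0_integral_reflect// Ilty.
  have E1 : (\int[mu]_u (cq%:E * I p u) = cq%:E * \int[mu]_u I p u)%E.
    by rewrite ge0_integralZl//; exact: mI.
  have E2 : (\int[mu]_u (cp%:E * I q (1 - u)%R) = cp%:E * \int[mu]_u I q (1 - u)%R)%E.
    by rewrite ge0_integralZl//; exact: mI1.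
  by rewrite E1 E2; apply: lte_add_pinfty; apply: lte_mul_pinfty; rewrite ?Ilty.
apply: ge0_le_integral => //.
- by move=> u _; exact: power_kernel2_ge0.
- exact: measurable_power_kernel2.
- exact: emeasurable_funD.
move=> u _.
have S0 : (0 <= cq%:E * I p u + cp%:E * I q (1 - u)%R)%E by rewrite adde_ge0// mule_ge0.
have [u0|u0] := leP u 0.
  by rewrite {1}/power_kernel ltNge u0 mul0r.
have [u1|u1] := leP 1 u.
  by rewrite {2}/power_kernel subr_gt0 ltNge u1 mulr0.
have IE r w : 0 < w < 1 -> I r w = (power_kernel r w)%:E.
  by move=> /andP[w0 w1]; rewrite /I patchE mem_set//= in_itv /= w0 ltW.
rewrite !IE; [|apply/andP; split; lra..].
rewrite -!EFinM -EFinD lee_fin.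
have [u2|u2] := leP u 2^-1.
  rewrite mulrC -[leLHS]addr0 lerD//.
    by rewrite ler_wpM2r ?power_kernel_ge0// le_power_kernel//; lra.
  by rewrite mulr_ge0// power_kernel_ge0.
rewrite -[leLHS]add0r lerD//.
  by rewrite mulr_ge0// power_kernel_ge0.
by rewrite ler_wpM2r ?power_kernel_ge0// le_power_kernel//; lra.
Qed.

Lemma truncated_beta_bounded (p q h : R) : 0 < p -> 0 < q -> p + q = 1 ->
  exists B : R, 0 < B /\ forall w, (truncated_beta p q h w <= B%:E)%E.
Proof.
move=> p0 q0 pq.
have := @beta_integral_lty p q ltac:(lra) ltac:(lra).
have : (0 <= \int[mu]_u (power_kernel p u * power_kernel q (1 - u))%:E)%E.
  by apply: integral_ge0 => u _; exact: power_kernel2_ge0.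
set b := (\int[mu]_u _)%E => b0 b_lty.
exists (fine b + 1); split; first by rewrite ltr_wpDl// fine_ge0.
move=> w; rewrite EFinD fineK ?ge0_fin_numE//.
have [w0|w0] := leP w 0; first by rewrite truncated_beta_le0// adde_ge0.
rewrite truncated_beta_scale//; apply: (@le_trans _ _ b); last by rewrite leeDl.
apply: ge0_subset_integral => //.
- exact: measurable_power_kernel2.
- by move=> u _; exact: power_kernel2_ge0.
Qed.

End beta_convolution.

(** * Positivity of the gamma function *)

Section Gamma_positive.
Context {R : realType}.
Notation mu := (@lebesgue_measure R).

(** Positivity also requires the integral to be finite, because [fine]
would send an infinite value to 0. The integrand is dominated by the power
kernel on ]0, 1] and by the exponential density on ]1, +oo[. *)
Lemma Gamma_gt0 (b : R) : 0 < b <= 1 -> 0 < Gamma b.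
Proof.
move=> /andP[b0 b1].
pose f (s : R) : \bar R := (s `^ (b - 1) * expR (- s))%:E.
have mf (D : set R) : measurable_fun D f.
  apply: measurable_funTS; apply/measurable_EFinP; apply: measurable_funM.
    exact: measurable_powR.
  by apply: measurableT_comp => //; exact: measurable_funN.
have f0 s : (0 <= f s)%E by rewrite lee_fin mulr_ge0// ?powR_ge0// expR_ge0.
have gt0 : (0 < \int[mu]_(s in `]0%R, +oo[) f s)%E.
  apply: (@lt_le_trans _ _
    (\int[mu]_(s in `[1%R, 2%R]) (2 `^ (b - 1) * expR (- 2))%:E)%E).
    rewrite integral_cst//= lebesgue_measure_itv /= lte_fin ltr1n -EFinD -EFinM lte_fin.
    by rewrite mulr_gt0 ?mulr_gt0 ?powR_gt0 ?expR_gt0//; lra.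
  apply: (@le_trans _ _ (\int[mu]_(s in `[1%R, 2%R]) f s)%E).
    apply: ge0_le_integral => //.
    - exact: mf.
    - move=> s /=; rewrite in_itv /= => /andP[s1 s2].
      rewrite lee_fin ler_pM ?powR_ge0 ?expR_ge0//.
        have := @le_power_kernel R b s 2 b1 ltac:(lra) s2.
        by rewrite /power_kernel !ifT//; lra.
      by rewrite ler_expR lerN2.
  apply: ge0_subset_integral;
    [exact: measurable_itv|exact: measurable_itv|exact: mf|by []|].
  by move=> s /=; rewrite !in_itv /= andbT => /andP[s1 _]; lra.
have lty : (\int[mu]_(s in `]0%R, +oo[) f s < +oo)%E.
  have -> : `]0%R, +oo[%classic = `]0%R, 1%R] `|` `]1%R, +oo[ :> set R.
    by rewrite -itv_bndbnd_setU// bnd_simp.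
  rewrite ge0_integral_setU//; [|exact: mf|]; last first.
    apply/disj_setPS => s [/=]; rewrite !in_itv /= andbT => /andP[_ s1].
    by rewrite ltNge s1.
  apply: lte_add_pinfty.
    apply: le_lt_trans (integral_power_lty b0 ltr01); apply: ge0_le_integral => //.
    - exact: mf.
    - apply: measurable_funTS; apply/measurable_EFinP.
      exact: measurable_power_kernel.
    - move=> s /=; rewrite in_itv /= => /andP[s0 _]; rewrite lee_fin /power_kernel s0.
      by rewrite ler_piMr ?powR_ge0// -expR0 ler_expR oppr_le0 ltW.
  have := @integral_exponential_pdf R 1 ltr01.
  move=> e1; apply: (@le_lt_trans _ _ 1%E); last exact: ltry.
  rewrite -e1 [leLHS]integral_mkcond; apply: ge0_le_integral => //.
  - by move=> s _; apply: erestrict_ge0.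
  - exact: measurable_fun_restrictT.
  - by apply/measurable_EFinP; exact: measurable_exponential_pdf.
  move=> s _; rewrite patchE; case: ifPn; last first.
    by rewrite lee_fin exponential_pdf_ge0.
  rewrite inE /= in_itv /= andbT => s1.
  rewrite lee_fin exponential_pdfE; last lra.
  rewrite mul1r mulN1r ler_piMl ?expR_ge0//.
  have := @le_power_kernel R b 1 s b1 ltr01 (ltW s1).
  by rewrite /power_kernel ltr01 powR1 ifT//; lra.
by rewrite /Gamma /Rintegral fine_gt0// gt0 lty.
Qed.
End Gamma_positive.

(** * Lower derivative bounds for absolutely continuous functions *)

Section absolutely_continuous.
Context {R : realType}.
Notation mu := (@lebesgue_measure R).
Implicit Types (c d t : R) (U : set R) (s : seq (R * R)).

(** Finite families of non-overlapping intervals, listed from right to left,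
with left bound c and right bound t, whose interiors lie in U: the order makes
such a family easy to extend on its right. *)
Fixpoint packed c U t s : Prop :=
  if s is p :: s' then
    [/\ c <= p.1, p.1 <= p.2, p.2 <= t, `]p.1, p.2[ `<=` U & packed c U p.1 s']
  else True.

Lemma packed_nth c U t s i : packed c U t s -> (i < size s)%N ->
  [/\ c <= (nth (0, 0) s i).1, (nth (0, 0) s i).1 <= (nth (0, 0) s i).2 &
      (nth (0, 0) s i).2 <= t].
Proof.
elim: s t i => //= p s IH t [|i] [cp p12 pt _ ps] /=; first by [].
rewrite ltnS => /(IH _ _ ps)[-> -> qp]; split => //.
exact: le_trans (le_trans qp p12) pt.
Qed.

Lemma packed_lt c U t s i j : packed c U t s -> (i < j < size s)%N ->
  (nth (0, 0) s j).2 <= (nth (0, 0) s i).1.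
Proof.
elim: s t i j => [|p s IH] t [|i] [|j] //=; rewrite ?andbF//.
  by move=> [_ _ _ _ ps]; rewrite ltnS => js; have [] := packed_nth ps js.
by move=> [_ _ _ _ ps]; rewrite !ltnS; exact: IH ps.
Qed.

Lemma packed_le c U t t' s : t <= t' -> packed c U t s -> packed c U t' s.
Proof. by case: s => //= p s tt' [cp pp pt pU ps]; split => //; exact: le_trans tt'. Qed.

Lemma packed_length c U t s : open U -> packed c U t s ->
  ((\sum_(p <- s) (p.2 - p.1))%:E <= mu (U `&` `]c, t[))%E.
Proof.
move=> oU; have mUI w : measurable (U `&` `]c, w[).
  by apply: measurableI => //; exact: open_measurable.
elim: s t => [|[u v] s IH] t /=; first by rewrite big_nil.
move=> [cu uv vt uvU /IH sU]; rewrite big_cons EFinD /=.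
apply: (@le_trans _ _ (mu (`]u, v[%classic `|` (U `&` `]c, u[)))); last first.
  apply: le_measure; rewrite ?inE.
  - by apply: measurableU => //; exact: mUI.
  - exact: mUI.
  - move=> w [uvw|[Uw cwu]]; split => //; [exact: uvU| |].
      by move: uvw; rewrite /= !in_itv /= => /andP[uw wv]; apply/andP; split; lra.
    by move: cwu; rewrite /= !in_itv /= => /andP[cw wu]; apply/andP; split; lra.
have -> : mu (`]u, v[ `|` (U `&` `]c, u[)) =
    (mu `]u, v[%classic + mu (U `&` `]c, u[))%E.
  apply: measureU => //; first exact: mUI.
  apply/seteqP; split => w //= []; rewrite !in_itv /= => /andP[uw _] [_] /andP[_].
  by rewrite ltNge (ltW uw).
rewrite lebesgue_measure_itv /= lte_fin.
case: ltP => uv'; first by rewrite leeD.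
have -> : v - u = 0 by lra.
by rewrite !add0e.
Qed.

(** The exceptional null set is covered by an open set U of small measure.
A point t is reachable from c when F t - F c >= - (k + e) (t - c) up to the
variation of F on a family of disjoint intervals of U. Every point has a
neighbourhood which can be crossed: by the derivative outside the exceptional
set, and by adding one interval to the family inside of it. The supremum of
the reachable points is therefore d. Absolute continuity makes the
variation on the family smaller than e, its total length being at most the
measure of U. *)
Lemma AC_derive_ge c d (k : R) (F : R -> R) : c <= d -> 0 <= k -> Defs.AC c d F ->
  {ae mu, forall t, c <= t <= d -> derivable F t 1 /\ - k <= derive1 F t} ->
  - k * (d - c) <= F d - F c.
Proof.
move=> cd k0 acF aeF.
suff approx (e : R) : 0 < e -> - (k + e) * (d - c) - e <= F d - F c.
  apply/ler_addgt0Pr => e e0.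
  have e'0 : 0 < e / (d - c + 1) by rewrite divr_gt0//; lra.
  have := approx _ e'0.
  suff : (e / (d - c + 1)) * (d - c) + e / (d - c + 1) = e by lra.
  by field; lra.
move=> e0; have [r r0 Fr] := acF e e0.
move: aeF => /negligible_outer_measure N0.
have [U [oU NU muU]] := outer_measure_open_le
  (~` [set t | c <= t <= d -> derivable F t 1 /\ - k <= derive1 F t])
  (divr_gt0 r0 (ltr0Sn R 1)).
rewrite N0 add0e in muU.
pose defect s := \sum_(p <- s) `|F p.2 - F p.1|.
(* The reachable points. *)
pose P t := c <= t <= d /\
  exists s, packed c U t s /\ - (k + e) * (t - c) - defect s <= F t - F c.
have step t : c <= t <= d -> exists2 h, 0 < h & forall u v,
    t - h < u -> u <= t -> t <= v -> v < t + h -> v <= d -> P u -> P v.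
  move=> /andP[ct td].
  have [Nt|Ut] :=
    pselect (c <= t <= d -> derivable F t 1 /\ - k <= derive1 F t); last first.
    have /nbhs_ballP[h /= h0 hU] : nbhs t U.
      by apply: open_nbhs_nbhs; split => //; exact: NU.
    exists h => // u v hu ut tv vh vd [/andP[cu _] [s [ps Ps]]].
    have uv : u <= v by exact: le_trans tv.
    split; first by rewrite (le_trans cu uv).
    exists ((u, v) :: s); split.
      split => //= w; rewrite /= in_itv /= => /andP[uw wv]; apply: hU.
      by rewrite /ball /= ltr_norml; apply/andP; split; lra.
    rewrite /defect big_cons -/(defect s) /=.
    have := ler_norm (- (F v - F u)); rewrite normrN.
    have : 0 <= (k + e) * (v - u) by rewrite mulr_ge0//; lra.
    by rewrite !mulNr; lra.
  have [|dF kF] := Nt; first by rewrite ct.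
  have [h h0 hF] : exists2 h, 0 < h & forall w, `|w - t| < h ->
      `|F w - F t - derive1 F t * (w - t)| <= e * `|w - t|.
    have : h^-1 *: (F (h *: 1 + t) - F t) @[h --> 0^'] --> derive1 F t.
      by rewrite derive1E; exact: dF.
    move=> /cvgrPdist_le/(_ e e0)[h /= h0 hF]; exists h => // w wt.
    have [->|wt0] := eqVneq w t; first by rewrite !subrr mulr0 subrr normr0 mulr0.
    have wt_neq0 : w - t != 0 by rewrite subr_eq0.
    have := hF (w - t); rewrite /ball /= sub0r normrN => /(_ wt wt_neq0).
    rewrite /GRing.scale /= mulr1 subrK => hw.
    have -> : F w - F t - derive1 F t * (w - t) =
        - ((derive1 F t - (w - t)^-1 * (F w - F t)) * (w - t)).
      by field.
    by rewrite normrN normrM ler_wpM2r.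
  exists h => // u v hu ut tv vh vd [/andP[cu _] [s [ps Ps]]].
  have uv : u <= v by exact: le_trans tv.
  split; first by rewrite (le_trans cu uv).
  exists s; split; first exact: packed_le ps.
  have := hF u; rewrite distrC ger0_norm ?subr_ge0// => /(_ ltac:(lra)).
  have := hF v; rewrite [`|v - t|]ger0_norm ?subr_ge0// => /(_ ltac:(lra)).
  rewrite !ler_norml => /andP[Fv _] /andP[_ Fu].
  have : 0 <= (derive1 F t + k) * (v - u) by rewrite mulr_ge0//; lra.
  by lra.
have Pc : P c.
  split; first by rewrite lexx.
  by exists [::]; rewrite /defect big_nil; split => //; lra.
have supP : has_sup [set t | P t].
  by split; [exists c|exists d => t [/andP[]]].
pose t := sup [set t | P t].
have [_ [s [ps Ps]]] : P d.
  have Pt_le u : P u -> u <= t by move=> Pu; exact: ub_le_sup supP.2 _ Pu.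
  have ct : c <= t by exact: Pt_le.
  have td : t <= d by apply: ge_sup => [|u [/andP[]]]; first by exists c.
  have [h h0 hP] : exists2 h, 0 < h & forall u v,
    t - h < u -> u <= t -> t <= v -> v < t + h -> v <= d -> P u -> P v.
    by apply: step; rewrite ct.
  have [u Pu hu] := sup_adherent h0 supP.
  have Pt : P t by apply: hP hu (Pt_le _ Pu) _ _ _ Pu => //; lra.
  have [->//|td'] := eqVneq d t.
  have {}td' : t < d by rewrite lt_neqAle eq_sym td' .
  have mt : t < Num.min d (t + h / 2) by rewrite lt_min td' ltrDl divr_gt0.
  have Pm : P (Num.min d (t + h / 2)).
    apply: (hP t) => //; [lra|exact: ltW| |by rewrite ge_min lexx].
    by rewrite gt_min; apply/orP; right; lra.
  by have := Pt_le _ Pm; rewrite leNgt mt.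
have : defect s < e.
  rewrite /defect (big_nth (0, 0)) big_mkord.
  apply: Fr.
  - by move=> i; have [-> -> vd] := packed_nth ps (ltn_ord i).
  - have sep (i j : 'I_(size s)) : (i < j)%N ->
        `](nth (0, 0) s i).1, (nth (0, 0) s i).2[ `&`
        `](nth (0, 0) s j).1, (nth (0, 0) s j).2[ = set0 :> set R.
      move=> ij; have ji : (nth (0, 0) s j).2 <= (nth (0, 0) s i).1.
        by apply: packed_lt ps _; rewrite ij ltn_ord.
      apply/seteqP; split => w //= []; rewrite !in_itv /= => /andP[iw _] /andP[_ wj].
      by have := lt_trans iw (lt_le_trans wj ji); rewrite ltxx.
    apply/trivIsetP => i j _ _; rewrite neq_lt => /orP[|] ij; first exact: sep.
    by rewrite setIC; exact: sep.
  - rewrite -(big_mkord xpredT (fun i => (nth (0, 0) s i).2 - (nth (0, 0) s i).1)).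
    rewrite -(big_nth (0, 0) xpredT (fun p : R * R => p.2 - p.1)) -lte_fin.
    apply: le_lt_trans (packed_length oU ps) _.
    apply: (@le_lt_trans _ _ (mu U)); last first.
      by apply: le_lt_trans muU _; rewrite lte_fin; lra.
    apply: le_measure; rewrite ?inE; last by move=> w [].
      by apply: measurableI => //; exact: open_measurable.
    exact: open_measurable.
by lra.
Qed.

End absolutely_continuous.

(** * Riemann-Liouville potentials and their averages *)

Section potential.
Context {R : realType}.
Notation mu := (@lebesgue_measure R).

(** This is Gamma q times the Riemann-Liouville integral of order q of z, with
lower terminal minus infinity; it is extended-valued so that Tonelli's theorem
applies to it directly. *)
Definition potential (q : R) (z : R -> R) (t : R) : \bar R :=
  (\int[mu]_s (power_kernel q (t - s) * z s)%:E)%E.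

Lemma measurable_potential_kernel (q : R) (z : R -> R) (t : R) :
  measurable_fun [set: R] z ->
  measurable_fun [set: R] (fun s => (power_kernel q (t - s) * z s)%:E).
Proof.
move=> mz; apply/measurable_EFinP; apply: measurable_funM => //.
by apply: (measurableT_comp (measurable_power_kernel q)); exact: measurable_funB.
Qed.

Lemma potential_lty (q a b M : R) (z : R -> R) (t : R) : 0 < q -> a < b -> 0 <= M ->
  measurable_fun [set: R] z -> (forall s, 0 <= z s <= M) ->
  (forall s, s < a -> z s = 0) -> t <= b -> (potential q z t < +oo)%E.
Proof.
move=> q0 ab M0 mz zM za tb.
pose I (u : R) : \bar R := (((EFin \o power_kernel q) \_ `]0%R, (b - a)%R]) u)%E.
have mI : measurable_fun [set: R] I.
  apply: measurable_fun_restrictT => //; apply/measurable_EFinP.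
  exact: measurable_power_kernel.
have I0 u : (0 <= I u)%E.
  by apply: erestrict_ge0 => {}u _; rewrite lee_fin power_kernel_ge0.
have ba0 : 0 < b - a by rewrite subr_gt0.
have Ilty : (\int[mu]_u I u < +oo)%E.
  by rewrite -integral_mkcond; exact: integral_power_lty.
have mIt : measurable_fun [set: R] (fun u => I (t - u)).
  by apply: (measurableT_comp mI); exact: measurable_funB.
apply: (@le_lt_trans _ _ (\int[mu]_s (M%:E * I (t - s)%R))%E).
  apply: ge0_le_integral => //.
  - by move=> s _; rewrite lee_fin mulr_ge0 ?power_kernel_ge0//; have /andP[] := zM s.
  - exact: measurable_potential_kernel.
  - exact: measurable_funeM.
  move=> s _; have [sa|sa] := ltP s a.
    by rewrite za// mulr0 mule_ge0.
  have [ts|ts] := leP (t - s) 0.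
    by rewrite /power_kernel ltNge ts mul0r mule_ge0.
  rewrite /I patchE mem_set /=; last by rewrite in_itv /= ts; lra.
  rewrite -EFinM lee_fin mulrC ler_wpM2r ?power_kernel_ge0//.
  by have /andP[] := zM s.
have E1 : (\int[mu]_s (M%:E * I (t - s)%R) = M%:E * \int[mu]_s I (t - s)%R)%E.
  by rewrite ge0_integralZl//; exact: mIt.
rewrite E1; apply: lte_mul_pinfty => //.
by rewrite -ge0_integral_reflect.
Qed.

End potential.

Section potential_averages.
Context {R : realType}.
Notation mu := (@lebesgue_measure R).

(** When p + q = 1, replacing h by +oo would give a multiple of the integral of
z up to t: this is inversion of the Abel transform, made local by the
truncation. *)
Definition beta_average (p q h : R) (z : R -> R) (t : R) : \bar R :=
  (\int[mu]_s ((z s)%:E * truncated_beta p q h (t - s)%R))%E.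

(** Tonelli's theorem: averaging the potential against u^(p - 1) on ]0, h[
amounts to convolving z with [truncated_beta]. *)
Lemma beta_averageE (p q h t : R) (z : R -> R) :
  measurable_fun [set: R] z -> (forall s, 0 <= z s) ->
  beta_average p q h z t =
  (\int[mu]_(u in `]0%R, h[) ((power_kernel p u)%:E * potential q z (t - u)%R))%E.
Proof.
move=> mz z0.
pose f (w : measurableTypeR R * measurableTypeR R) : \bar R :=
  (\1_`]0, h[ w.1 * power_kernel p w.1 * (power_kernel q (t - w.1 - w.2) * z w.2))%:E.
have mf : measurable_fun setT f.
  apply/measurable_EFinP; apply: measurable_funM.
    apply: measurable_funM; last exact: (measurableT_comp (measurable_power_kernel p)).
    exact: measurableT_comp.
  apply: measurable_funM; last exact: (measurableT_comp mz).
  apply: (measurableT_comp (measurable_power_kernel q)).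
  by apply: measurable_funB => //; exact: measurable_funB.
have f0 w : (0 <= f w)%E by rewrite lee_fin !mulr_ge0// power_kernel_ge0.
have := @fubini_tonelli _ _ _ _ R mu mu f mf f0.
rewrite /beta_average => fubini; apply/esym.
have <- : (\int[mu]_x \int[mu]_y f (x, y) =
    \int[mu]_(u in `]0%R, h[) ((power_kernel p u)%:E * potential q z (t - u)%R))%E.
  rewrite [RHS]integral_mkcond; apply: eq_integral => u _.
  rewrite patchE /f /= indicE; case: ifPn => uD; last first.
    by rewrite integral0_eq// => s _; rewrite !mul0r.
  under eq_integral do rewrite mul1r EFinM.
  rewrite ge0_integralZl//.
  - by apply: measurable_potential_kernel.
  - by move=> s _; rewrite lee_fin mulr_ge0// power_kernel_ge0.
  - by rewrite lee_fin power_kernel_ge0.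
rewrite fubini; apply: eq_integral => s _.
rewrite /truncated_beta -ge0_integralZl ?lee_fin//; last 2 first.
- by apply: measurable_funTS; exact: measurable_power_kernel2.
- by move=> u _; exact: power_kernel2_ge0.
rewrite [RHS]integral_mkcond.
apply: eq_integral => u _; rewrite patchE /f /= indicE; case: ifPn => uD; last first.
  by rewrite !mul0r.
by rewrite mul1r -EFinM (_ : t - s - u = t - u - s); [congr _%:E; ring|ring].
Qed.

Lemma measurable_potential (q : R) (z : R -> R) :
  measurable_fun [set: R] z -> (forall s, 0 <= z s) ->
  measurable_fun [set: R] (potential q z).
Proof.
move=> mz z0.
pose f (w : measurableTypeR R * measurableTypeR R) : \bar R :=
  (power_kernel q (w.1 - w.2) * z w.2)%:E.
have mf : measurable_fun setT f.
  apply/measurable_EFinP; apply: measurable_funM; last exact: (measurableT_comp mz).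
  apply: (measurableT_comp (measurable_power_kernel q)).
  exact: measurable_funB.
have f0 w : (0 <= f w)%E by rewrite lee_fin mulr_ge0// power_kernel_ge0.
exact: (@measurable_fun_fubini_tonelli_F _ _ _ _ R mu f mf f0).
Qed.

Lemma measurable_truncated_beta (p q h : R) :
  measurable_fun [set: R] (truncated_beta p q h).
Proof.
pose f (w : measurableTypeR R * measurableTypeR R) : \bar R :=
  (\1_`]0, h[ w.2 * (power_kernel p w.2 * power_kernel q (w.1 - w.2)))%:E.
have mf : measurable_fun setT f.
  apply/measurable_EFinP; apply: measurable_funM; first exact: measurableT_comp.
  apply: measurable_funM; first exact: (measurableT_comp (measurable_power_kernel p)).
  apply: (measurableT_comp (measurable_power_kernel q)).
  exact: measurable_funB.
have f0 w : (0 <= f w)%E by rewrite lee_fin !mulr_ge0// power_kernel_ge0.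
have -> : truncated_beta p q h = fubini_F mu f; last first.
  exact: (@measurable_fun_fubini_tonelli_F _ _ _ _ R mu f mf f0).
apply/funext => w; rewrite /fubini_F /truncated_beta [LHS]integral_mkcond.
apply: eq_integral => u _; rewrite patchE /f /= indicE; case: ifPn => uD.
  by rewrite mul1r.
by rewrite mul0r.
Qed.

Lemma measurable_beta_average_kernel (p q h t : R) (z : R -> R) :
  measurable_fun [set: R] z ->
  measurable_fun [set: R] (fun s => (z s)%:E * truncated_beta p q h (t - s)%R)%E.
Proof.
move=> mz; apply: emeasurable_funM; first exact/measurable_EFinP.
apply: (measurableT_comp (measurable_truncated_beta p q h)).
exact: measurable_funB.
Qed.

Lemma beta_average_kernel_ge0 (p q h t : R) (z : R -> R) (s : R) :
  0 <= z s -> (0 <= (z s)%:E * truncated_beta p q h (t - s)%R)%E.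
Proof. by move=> z0; rewrite mule_ge0 ?lee_fin// truncated_beta_ge0. Qed.

Lemma potential_ge0 (q : R) (z : R -> R) (t : R) :
  (forall s, 0 <= z s) -> (0 <= potential q z t)%E.
Proof.
by move=> z0; apply: integral_ge0 => s _; rewrite lee_fin mulr_ge0// power_kernel_ge0.
Qed.

(** A lower bound of the increments of the potential just before b passes to
its averages; u^(p - 1) >= h^(p - 1) on ]0, h[ gives the constant. *)
Lemma beta_average_lower (p q b h d : R) (z : R -> R) :
  p <= 1 -> 0 < h -> 0 <= d ->
  measurable_fun [set: R] z -> (forall s, 0 <= z s) ->
  forall k : R,
  (forall t : R, b - h < t < b ->
     (potential q z (t - k)%R + d%:E <= potential q z t)%E) ->
  (beta_average p q h z (b - k)%R + (d * (power_kernel p h * h))%:E <=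
   beta_average p q h z b)%E.
Proof.
move=> p1 h0 d0 mz z0 k pot.
rewrite !(beta_averageE p q h _ mz z0).
have mX t : measurable_fun [set: R]
    (fun u => (power_kernel p u)%:E * potential q z (t - u)%R)%E.
  apply: emeasurable_funM; first by apply/measurable_EFinP; exact: measurable_power_kernel.
  by apply: (measurableT_comp (@measurable_potential q z mz z0)); exact: measurable_funB.
have pX0 t u : (0 <= (power_kernel p u)%:E * potential q z (t - u)%R)%E.
  by rewrite mule_ge0 ?potential_ge0// lee_fin power_kernel_ge0.
have c0 : (0 <= (power_kernel p h * d)%:E)%E by rewrite lee_fin mulr_ge0// power_kernel_ge0.
have -> : (d * (power_kernel p h * h))%:E =
    (\int[mu]_(u in `]0%R, h[) (power_kernel p h * d)%:E)%E.
  rewrite integral_cst//= lebesgue_measure_itv /= lte_fin h0 oppr0 adde0 -EFinM.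
  by congr _%:E; ring.
rewrite -ge0_integralD//; last by apply: measurable_funTS; exact: mX.
apply: ge0_le_integral => //.
- by move=> u _; exact: adde_ge0.
- by apply: measurable_funTS; apply: emeasurable_funD; [exact: mX|exact: measurable_cst].
- by apply: measurable_funTS; exact: mX.
move=> u; rewrite /= in_itv /= => /andP[u0 uh].
have potu : (potential q z (b - k - u)%R + d%:E <= potential q z (b - u)%R)%E.
  have -> : b - k - u = b - u - k by ring.
  by apply: pot; apply/andP; split; lra.
apply: (@le_trans _ _ ((power_kernel p u)%:E * (potential q z (b - k - u)%R + d%:E))%E);
  last by apply: lee_wpmul2l potu; rewrite lee_fin power_kernel_ge0.
have d0' : (0 <= d%:E)%E by rewrite lee_fin.
rewrite (ge0_muleDr _ (@potential_ge0 q z _ z0) d0').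
rewrite leeD2l// -EFinM lee_fin ler_wpM2r//.
by apply: le_power_kernel => //; exact: ltW.
Qed.

(** As [truncated_beta] is nonincreasing on ]0, +oo[, shifting b - k to b only
adds the mass of z on [b - k, b]: the rest of the integral decreases. *)
Lemma beta_average_upper (p q h b k r B : R) (z : R -> R) :
  0 < q -> p + q = 1 -> 0 < h -> 0 < k -> 0 <= r -> 0 <= B ->
  measurable_fun [set: R] z -> (forall s, 0 <= z s) ->
  (forall w, (truncated_beta p q h w <= B%:E)%E) ->
  (forall s, b - k <= s <= b -> z s <= r) ->
  (beta_average p q h z b <= beta_average p q h z (b - k)%R + (r * B * k)%:E)%E.
Proof.
move=> q0 pq h0 k0 r0 B0 mz z0 tbB zr.
have mI : measurable_fun [set: R] (fun s => (\1_(`[(b - k)%R, b]) s : R)%:E).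
  exact/measurable_EFinP.
have -> : (r * B * k)%:E = (\int[mu]_s (r * B * \1_(`[(b - k)%R, b]) s)%:E)%E.
  under eq_integral do rewrite EFinM.
  rewrite ge0_integralZl ?lee_fin//; last by rewrite mulr_ge0.
  rewrite integral_indic// setIT /= lebesgue_measure_itv /= lte_fin ltrBlDr ltrDl k0.
  by rewrite -EFinD -EFinM; congr _%:E; ring.
have mJ t := measurable_beta_average_kernel p q h t mz.
have mrB : measurable_fun [set: R] (fun s => (r * B * \1_(`[(b - k)%R, b]) s)%:E).
  by apply/measurable_EFinP; exact: measurable_funM.
have J0 t s : (0 <= (z s)%:E * truncated_beta p q h (t - s)%R)%E.
  exact: beta_average_kernel_ge0.
have rB0 s : (0 <= (r * B * \1_(`[(b - k)%R, b]) s)%:E)%E by rewrite lee_fin !mulr_ge0.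
rewrite -ge0_integralD//; last exact: mJ.
apply: ge0_le_integral => //.
- exact: mJ.
- by apply: emeasurable_funD; [exact: mJ|exact: mrB].
move=> s _; rewrite indicE.
have [ks|ks] := ltP s (b - k).
  rewrite memNset /=; last by rewrite in_itv /= leNgt ks.
  rewrite mulr0 adde0; apply: lee_wpmul2l; first by rewrite lee_fin.
  by apply: truncated_beta_nonincreasing => //; lra.
have [sb|sb] := leP s b; last first.
  rewrite [X in (_ * X <= _)%E](truncated_beta_le0 p q h (_ : b - s <= 0)) ?mule0; last lra.
  by apply: adde_ge0; [exact: J0|rewrite lee_fin !mulr_ge0].
rewrite mem_set /=; last by rewrite in_itv /= ks sb.
rewrite mulr1 (@le_trans _ _ (r * B)%:E)//; last by rewrite leeDr.
rewrite EFinM lee_pmul ?lee_fin ?truncated_beta_ge0//.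
by rewrite zr// ks sb.
Qed.

Lemma beta_average_lty (p q h a b t M B : R) (z : R -> R) :
  a < b -> t <= b ->
  measurable_fun [set: R] z -> (forall s, 0 <= z s <= M) ->
  (forall s, s < a -> z s = 0) ->
  (forall w, (truncated_beta p q h w <= B%:E)%E) ->
  (beta_average p q h z t < +oo)%E.
Proof.
move=> ab tb mz zM za tbB.
have z0 s : 0 <= z s by have /andP[] := zM s.
have B0 : 0 <= B by rewrite -lee_fin (le_trans _ (tbB 0))// truncated_beta_ge0.
have M0 : 0 <= M by have /andP[/le_trans h0 /h0] := zM a.
apply: (@le_lt_trans _ _ (\int[mu]_(s in `[a, b]) (M * B)%:E)%E); last first.
  by rewrite integral_cst//= lebesgue_measure_itv /= lte_fin ab -EFinD -EFinM ltry.
rewrite [leRHS]integral_mkcond; apply: ge0_le_integral => //.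
- by move=> s _; exact: beta_average_kernel_ge0.
- exact: measurable_beta_average_kernel.
- by apply: measurable_fun_restrictT => //; exact: measurable_cst.
move=> s _; rewrite patchE.
have MB0 : (0 <= (M * B)%:E)%E by rewrite lee_fin mulr_ge0.
have [sa|sa] := ltP s a; first by rewrite za// mul0e; case: ifP.
have [sb|sb] := leP s b; last first.
  by rewrite truncated_beta_le0 ?mule0; [case: ifP|lra].
rewrite mem_set /=; last by rewrite in_itv /= sa.
rewrite EFinM lee_pmul ?lee_fin ?truncated_beta_ge0//.
by have /andP[] := zM s.
Qed.

(** A nonnegative function whose potential grows at a positive rate just before
b cannot tend to 0 at b: the two bounds on the averages would force
e k c <= r B k with r arbitrarily small. *)
Lemma abel_strict (p q a b h1 M e : R) (z : R -> R) :
  0 < p -> 0 < q -> p + q = 1 -> a < b -> 0 < h1 -> 0 < e ->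
  measurable_fun [set: R] z -> (forall s, 0 <= z s <= M) ->
  (forall s, s < a -> z s = 0) ->
  (forall t h : R, b - h1 < t < b -> 0 < h < h1 ->
     (potential q z (t - h)%R + (e * h)%:E <= potential q z t)%E) ->
  exists2 r : R, 0 < r & forall h : R, 0 < h -> exists2 s : R, b - h <= s <= b & r <= z s.
Proof.
move=> p0 q0 pq ab h10 e0 mz zM za pot.
have z0 s : 0 <= z s by have /andP[] := zM s.
have [B [B0 tbB]] := truncated_beta_bounded h1 p0 q0 pq.
pose c := power_kernel p h1 * h1.
have c0 : 0 < c by rewrite mulr_gt0// /power_kernel h10 powR_gt0.
(* Half of the value for which the two bounds would balance. *)
pose r := e * c / (2 * B).
have r0 : 0 < r by apply: divr_gt0; exact: mulr_gt0.
exists r => // h h0.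
pose k := Num.min h (h1 / 2).
have k0 : 0 < k by rewrite lt_min h0 divr_gt0.
have kh : k <= h by rewrite ge_min lexx.
have kh1 : k < h1 by rewrite gt_min; apply/orP; right; lra.
apply: contrapT => Nz.
have zr (s : R) : b - k <= s <= b -> z s <= r.
  move=> /andP[ks sb]; rewrite leNgt; apply/negP => rz; apply: Nz.
  by exists s; [apply/andP; split => //; lra|exact: ltW].
have lower : (beta_average p q h1 z (b - k)%R + (e * k * c)%:E <=
    beta_average p q h1 z b)%E.
  apply: beta_average_lower => //; [lra|by rewrite ltW// mulr_gt0|].
  by move=> t tb; apply: pot => //; rewrite k0.
have upper := beta_average_upper q0 pq h10 k0 (ltW r0) (ltW B0) mz z0 tbB zr.
have fin : (beta_average p q h1 z (b - k)%R \is a fin_num)%E.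
  rewrite ge0_fin_numE; last by apply: integral_ge0 => s _; exact: beta_average_kernel_ge0.
  by apply: (beta_average_lty ab _ mz zM za tbB); lra.
have := le_trans lower upper.
rewrite leeD2lE// lee_fin.
have -> : r * B * k = e * k * c / 2 by rewrite /r; field; lra.
have : 0 < e * k * c by apply: mulr_gt0 => //; exact: mulr_gt0.
by lra.
Qed.

End potential_averages.

Section potential_difference.
Context {R : realType}.
Notation mu := (@lebesgue_measure R).

(** Translating by h sends the potential of [a, b] at t - h to that of
[a + h, b + h] at t; the piece [a, a + h[ is gained, on which the kernel is at
least its value at b - a. *)
Lemma potential_indic_growth (q a b t h : R) :
  q <= 1 -> 0 < h -> a <= t - h -> t <= b ->
  (potential q \1_`[a, b] (t - h)%R + (power_kernel q (b - a) * h)%:E <=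
   potential q \1_`[a, b] t)%E.
Proof.
move=> q1 h0 ath tb; rewrite {1}/potential.
have m1 : measurable_fun [set: R] (\1_`[a, b] : R -> R) by exact: measurable_indic.
have mK s := measurable_potential_kernel q s m1.
have K0 s u : (0 <= (power_kernel q (s - u) * \1_`[a, b] u)%:E)%E.
  by rewrite lee_fin mulr_ge0// power_kernel_ge0.
rewrite (@ge0_integral_affine R 1 (- h) _ ltr01 (mK _) (K0 _)) mul1e.
have mI : measurable_fun [set: R] (fun s => (\1_(`[a, (a + h)%R[) s : R)%:E).
  exact/measurable_EFinP.
have mcI : measurable_fun [set: R]
    (fun s => (power_kernel q (b - a) * \1_(`[a, (a + h)%R[) s)%:E).
  by apply/measurable_EFinP; exact: measurable_funM.
have cI0 s : (0 <= (power_kernel q (b - a) * \1_(`[a, (a + h)%R[) s)%:E)%E.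
  by rewrite lee_fin mulr_ge0// power_kernel_ge0.
have -> : (power_kernel q (b - a) * h)%:E =
    (\int[mu]_s (power_kernel q (b - a) * \1_(`[a, (a + h)%R[) s)%:E)%E.
  under eq_integral do rewrite EFinM.
  rewrite ge0_integralZl ?lee_fin ?power_kernel_ge0//.
  rewrite integral_indic// setIT /= lebesgue_measure_itv /= lte_fin ltrDl h0.
  by rewrite -EFinD -EFinM; congr _%:E; ring.
have mK' : measurable_fun [set: R]
    (fun s => (power_kernel q (t - h - (1 * s - h)) * \1_`[a, b] (1 * s - h))%:E).
  apply: (measurableT_comp (mK (t - h))).
  by apply: measurable_funB => //; exact: measurable_funM.
rewrite -ge0_integralD//.
apply: ge0_le_integral => //.
- by move=> s _; rewrite adde_ge0.
- by apply: emeasurable_funD; [exact: mK'|exact: mcI].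
- exact: mK.
move=> s _; rewrite -EFinD lee_fin mul1r (_ : t - h - (s - h) = t - s); last by ring.
rewrite !indicE !mem_setE !in_itv /=.
have pk0 := power_kernel_ge0 q (t - s).
have [sa|sa] := ltP s a.
  have -> : (a <= s - h <= b) = false by apply/negP; lra.
  by rewrite !mulr0 addr0.
have [st|st] := leP t s.
  rewrite {1 3}/power_kernel subr_gt0 ltNge st !mul0r add0r.
  have -> : (s < a + h) = false by apply/negP; lra.
  by rewrite mulr0.
have -> : s <= b by lra.
rewrite mulr1; have [sah|sah] := ltP s (a + h).
  have -> : (a <= s - h <= b) = false by apply/negP; lra.
  by rewrite mulr0 add0r mulr1; apply: le_power_kernel => //; lra.
by rewrite mulr0 addr0 ler_piMr// lern1 leq_b1.
Qed.

Lemma integrable_potential (q a b M t : R) (z : R -> R) : 0 < q -> a < b -> 0 <= M ->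
  measurable_fun [set: R] z -> (forall s, 0 <= z s <= M) ->
  (forall s, s < a -> z s = 0) -> t <= b ->
  mu.-integrable setT (EFin \o (fun s => power_kernel q (t - s) * z s)).
Proof.
move=> q0 ab M0 mz zM za tb; apply/integrableP; split.
  exact: measurable_potential_kernel.
have := potential_lty q0 ab M0 mz zM za tb.
rewrite (_ : potential q z t = \int[mu]_s `|(power_kernel q (t - s) * z s)%:E|)%E//.
apply: eq_integral => s _; rewrite gee0_abs// lee_fin mulr_ge0 ?power_kernel_ge0//.
by have /andP[] := zM s.
Qed.

(** Splitting x - x(a) into two nonnegative functions expresses the signed
integral through two finite potentials. *)
Lemma Rintegral_rl_kernel (q a b M t : R) (x : R -> R) : 0 < q < 1 -> a < b -> 0 <= M ->
  measurable_fun [set: R] (x \_ `[a, b]) ->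
  (forall s, 0 <= (x \_ `[a, b]) s <= M) -> a <= t <= b ->
  \int[mu]_(s in `[a, t]) rl_kernel q (fun s => x s - x a) t s =
  fine (potential q (x \_ `[a, b]) t) - x a * fine (potential q \1_`[a, b] t).
Proof.
move=> /andP[q0 q1] ab M0 mx xM /andP[at_ tb].
have m1 : measurable_fun [set: R] (\1_`[a, b] : R -> R) by exact: measurable_indic.
have i1 : mu.-integrable setT (EFin \o (fun s => power_kernel q (t - s) * \1_`[a, b] s)).
  apply: (integrable_potential (M := 1) q0 ab) => //.
  - by move=> s; rewrite indicE ler0n lern1 leq_b1.
  - by move=> s sa; rewrite indicE mem_setE in_itv /= leNgt sa.
have i2 : mu.-integrable setT (EFin \o (fun s => power_kernel q (t - s) * (x \_ `[a, b]) s)).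
  apply: (integrable_potential q0 ab M0) => //.
  by move=> s sa; rewrite patchE mem_setE in_itv /= leNgt sa.
rewrite Rintegral_mkcond.
transitivity (\int[mu]_s (power_kernel q (t - s) * (x \_ `[a, b]) s -
    x a * (power_kernel q (t - s) * \1_`[a, b] s))).
  congr fine; apply: eq_integral => s _; congr _%:E.
  rewrite !patchE indicE !mem_setE !in_itv /=.
  have [sa|sa] := ltP s a; first by rewrite !mulr0 subr0.
  have [ts|st] := ltP t s.
    by rewrite /power_kernel subr_gt0 ltNge (ltW ts) !mul0r mulr0 subr0.
  have -> : s <= b by lra.
  rewrite /rl_kernel /power_kernel subr_gt0 mulr1 mulrBr (mulrC (x a)).
  have [//|ts] := ltP s t.
  (* At s = t both kernels vanish, as 0 `^ r = 0 for r <> 0. *)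
  have -> : t - s = 0 by lra.
  by rewrite powR0 ?mul0r ?subr0// lt_eqF//; lra.
rewrite RintegralB//; last by have := integrableZl measurableT (x a) i1.
by rewrite RintegralZl.
Qed.

End potential_difference.

(** * Positivity of the solution *)

Section half_line.
Context {R : realType}.
Implicit Types (a : R) (f : R -> R).

Lemma within_half_line_dist a f t (e : R) : {within `[a, +oo[, continuous f} ->
  a <= t -> 0 < e ->
  exists2 d : R, 0 < d & forall s, a <= s -> `|s - t| < d -> `|f s - f t| < e.
Proof.
move=> /subspace_continuousP/(_ t) cf at_ e0.
have {}cf := cf ltac:(by rewrite /= in_itv /= at_).
move/cvgrPdist_lt/(_ e e0) : cf => [d /= d0 hd]; exists d => // s as_ std.
by rewrite distrC; apply: hd; rewrite /ball_ /= ?in_itv /= ?as_// distrC.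
Qed.

Lemma exists_first_zero a f t : {within `[a, +oo[, continuous f} -> 0 < f a ->
  a <= t -> f t <= 0 ->
  exists b : R, [/\ a < b, f b = 0 & forall s, a <= s -> s < b -> 0 < f s].
Proof.
move=> cf fa at_ ft.
pose S := [set s | a <= s /\ f s <= 0].
have St : S t by [].
have lbS : lbound S a by move=> s [].
have infS : has_inf S by split; [exists t|exists a].
pose b := inf S.
have ab : a <= b by apply: lb_le_inf => //; exists t.
have pos s : a <= s -> s < b -> 0 < f s.
  move=> as_ sb; rewrite ltNge; apply/negP => fs.
  by have := ge_inf infS.2 (conj as_ fs); rewrite leNgt sb.
have fb0 : f b <= 0.
  rewrite leNgt; apply/negP => fb.
  have [d d0 hd] := within_half_line_dist cf ab fb.
  have [s [as_ fs] sb] := inf_adherent d0 infS.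
  have bs := ge_inf infS.2 (conj as_ fs : S s).
  have := hd s as_; rewrite ger0_norm ?subr_ge0// => /(_ ltac:(lra)).
  by rewrite ltr_norml => /andP[? _]; lra.
have {}ab : a < b.
  by rewrite lt_neqAle ab andbT; apply/negP => /eqP ab'; move: fb0; rewrite -ab' leNgt fa.
exists b; split => //; apply/eqP; rewrite eq_le fb0 /= leNgt; apply/negP => fb.
have fbN : 0 < - f b by rewrite oppr_gt0.
have [d d0 hd] := within_half_line_dist cf (ltW ab) fbN.
pose s := Num.max a (b - d / 2).
have as_ : a <= s by rewrite le_max lexx.
have sb : s < b by rewrite gt_max ab /= ltrBlDr ltrDl divr_gt0.
have bs : b - d / 2 <= s by rewrite le_max lexx orbT.
have := hd s as_; rewrite distrC ger0_norm ?subr_ge0 1?ltW// => /(_ ltac:(lra)).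
have := pos s as_ sb; rewrite ltr_norml => ? /andP[_ ?]; lra.
Qed.

End half_line.

(** The bookkeeping behind the growth of X_x: in X_x = Gamma(q) F + x(a) X_1 the
rate of decrease allowed for F consumes one half of the growth of x(a) X_1. *)
Lemma growth_of_difference {R : realType} (G xa c h P0 P1 L0 L1 F0 F1 : R) :
  0 < G -> 0 < xa -> G * F0 = P0 - xa * L0 -> G * F1 = P1 - xa * L1 ->
  - (xa * c / (2 * G)) * h <= F1 - F0 -> L0 + c * h <= L1 ->
  P0 + xa * c / 2 * h <= P1.
Proof.
move=> G0 xa0 FE0 FE1 gF gL.
have gL' : xa * (L0 + c * h) <= xa * L1 by rewrite ler_pM2l.
have gF' : G * (- (xa * c / (2 * G)) * h) <= G * (F1 - F0) by rewrite ler_pM2l.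
have E1 : G * (- (xa * c / (2 * G)) * h) = - (xa * c / 2 * h) by field; lra.
have E2 : xa * (L0 + c * h) = xa * L0 + 2 * (xa * c / 2 * h) by field.
move: gF' gL'; rewrite E1 E2 mulrBr FE0 FE1.
lra.
Qed.

Unset Implicit Arguments.

Theorem theorem1p4 (R : realType) (a alpha : R) (g : R -> R) (xa : R)
    (halpha0 : 0 < alpha) (halpha1 : alpha < 1)
    (hg : {within `[a, +oo[, continuous g}) (hxa : 0 < xa)
    (x : R -> R) (hx : caputo_linear_solution a alpha g xa x) :
  forall t : R, a <= t -> 0 < x t.
Proof.
move=> t0 at0; rewrite ltNge; apply/negP => xt0.
case: hx => -[cx [_ _ acF]] eqn xE; subst xa.
have [b [ab xb pos]] := exists_first_zero cx hxa at0 xt0.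
set y := (fun s => x s - x a) in acF eqn *.
pose q := 1 - alpha.
have q01 : 0 < q < 1 by rewrite /q; apply/andP; split; lra.
have [q0 q1] := andP q01.
pose F := rl_integral a q y.
pose z := x \_ `[a, b].
have cab : {within `[a, b], continuous x}.
  apply: continuous_subspaceW cx => s /=; rewrite !in_itv /= andbT.
  by case/andP.
have mz : measurable_fun [set: R] z.
  by apply/(measurable_restrictT x) => //; exact: subspace_continuous_measurable_fun.
have zE s : a <= s <= b -> z s = x s.
  by move=> asb; rewrite /z patchE mem_set.
have x0 s : a <= s <= b -> 0 <= x s.
  move=> /andP[as_]; rewrite le_eqVlt => /predU1P[->|sb]; first by rewrite xb.
  by apply: ltW; exact: pos.
have [M M0 zM] : exists2 M, 0 <= M & forall s, 0 <= z s <= M.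
  have [m mab xm] := EVT_max (ltW ab) cab.
  have xm0 : 0 <= x m by apply: x0; move: mab; rewrite in_itv.
  exists (x m) => // s; rewrite /z patchE mem_setE in_itv /=.
  case: ifPn => [asb|_]; last by rewrite lexx.
  by rewrite x0// xm// in_itv.
have za s : s < a -> z s = 0 by move=> sa; rewrite /z patchE mem_setE in_itv /= leNgt sa.
have G0 : 0 < Gamma q by apply: Gamma_gt0; rewrite q0 ltW.
have FE t : a <= t <= b ->
    Gamma q * F t = fine (potential q z t) - x a * fine (potential q \1_`[a, b] t).
  move=> atb; rewrite -(Rintegral_rl_kernel q01 ab M0)//.
  by rewrite /F /rl_integral gt_eqF// mulrA divff ?mul1r// gt_eqF.
pose c := power_kernel q (b - a).
have c0 : 0 < c by rewrite /c /power_kernel subr_gt0 ab powR_gt0// subr_gt0.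
(* The rate of decrease of F that uses up half of the growth of x(a) X_1. *)
pose m := x a * c / (2 * Gamma q).
have m0 : 0 < m by apply: divr_gt0; exact: mulr_gt0.
have cgx : {within `[a, +oo[, continuous (fun s => g s * x s)}.
  by move=> s; apply: cvgM; [exact: hg|exact: cx].
have [d d0 hd] := within_half_line_dist cgx (ltW ab) m0.
have growF t h : b - d < t - h -> a <= t - h -> 0 < h -> t <= b ->
    - m * h <= F t - F (t - h).
  move=> bdt ath h0 tb.
  rewrite (_ : - m * h = - m * (t - (t - h))); last by ring.
  apply: AC_derive_ge => //; [lra|exact: ltW| |].
    by apply: acF => s /=; rewrite !in_itv /= andbT => /andP[? _]; lra.
  move: eqn; apply: negligibleS; apply: subsetC => s /= eqs /andP[ts st].
  have as_ : a <= s by lra.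
  have [dFs Fs] := eqs as_; split; first exact: dFs.
  rewrite [derive1 _ _]Fs.
  have := hd s as_; rewrite xb mulr0 subr0 distrC ger0_norm ?subr_ge0; last lra.
  by move=> /(_ ltac:(lra)); rewrite ltr_norml => /andP[? _]; exact: ltW.
pose h1 := Num.min (d / 2) ((b - a) / 2).
have h10 : 0 < h1 by rewrite lt_min !divr_gt0// subr_gt0.
have h1d : h1 <= d / 2 by rewrite ge_min lexx.
have h1ab : h1 <= (b - a) / 2 by rewrite ge_min lexx orbT.
pose e := x a * c / 2.
have e0 : 0 < e by rewrite divr_gt0// mulr_gt0.
have [r r0 hr] : exists2 r : R, 0 < r &
    forall h : R, 0 < h -> exists2 s : R, b - h <= s <= b & r <= z s.
  apply: (abel_strict halpha0 q0 _ ab h10 e0 mz zM za); first by rewrite /q; lra.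
  move=> t h /andP[bt tb] /andP[h0 hh1].
  have finz s : s <= b -> (potential q z s \is a fin_num)%E.
    move=> sb; rewrite ge0_fin_numE; first exact: potential_lty q0 ab M0 mz zM za sb.
    by apply: potential_ge0 => w; have /andP[] := zM w.
  have finI s : s <= b -> (potential q \1_`[a, b] s \is a fin_num)%E.
    move=> sb; rewrite ge0_fin_numE; last by apply: potential_ge0.
    apply: (potential_lty (M := 1) q0 ab) sb => //.
    + by move=> w; rewrite indicE ler0n lern1 leq_b1.
    + by move=> w wa; rewrite indicE mem_setE in_itv /= leNgt wa.
  have ath : a <= t - h by lra.
  have tb' := ltW tb.
  have thb : t - h <= b by lra.
  have gL := potential_indic_growth (ltW q1) h0 ath tb'.
  rewrite -(fineK (finI _ tb')) -(fineK (finI _ thb)) lee_fin in gL.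
  rewrite -(fineK (finz _ tb')) -(fineK (finz _ thb)) lee_fin.
  apply: growth_of_difference G0 hxa (FE _ _) (FE _ _) (growF t h _ ath h0 tb') gL.
  - by rewrite ath.
  - by rewrite tb' andbT; lra.
  - lra.
have [d' d'0 hd'] := within_half_line_dist cx (ltW ab) r0.
pose h := Num.min (d' / 2) (b - a).
have h0 : 0 < h by rewrite lt_min divr_gt0// subr_gt0.
have hd2 : h <= d' / 2 by rewrite ge_min lexx.
have hab : h <= b - a by rewrite ge_min lexx orbT.
have [s /andP[hs sb]] := hr h h0.
have as_ : a <= s by lra.
rewrite zE ?as_//; apply/negP; rewrite -ltNge.
have := hd' s as_; rewrite xb subr0 distrC ger0_norm ?subr_ge0//.
by move=> /(_ ltac:(lra)); exact: le_lt_trans (ler_norm _).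
Qed.
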